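(* Let $G$ be an arbitrary finitely generated group. Then $cf(G)=eq(G)$, where $cf(G)$ is the number of conjugacy classes of elements of finite order in $G$, and $eq(G)$ is the number of equivalence classes of the relation $\sim$ on the set $F(G)$.
   Context: Let $\underline{E}G$ be a model for the classifying space for proper actions (a $G$-CW-complex with $\underline{E}G^H=\emptyset$ for infinite $H\le G$ and contractible for finite $H\le G$), and let $\underline{B}G=\underline{E}G/G$. For each cell $\sigma$ of $\underline{B}G$ fix a lift $\tilde\sigma$ in $\underline{E}G$, with finite stabilizer $G_{\tilde\sigma}\le G$. For a cell $\sigma$ of $\underline{B}G$ with boundary cell $\tau$, choose a lift $\tilde\tau'$ of $\tau$ lying in the boundary of $\tilde\sigma$ and an element $g_{\sigma,\tau}\in G$ with $g_{\sigma,\tau}\tilde\tau'=\tilde\tau$. Let $\phi_\sigma^\tau:G_{\tilde\sigma}\hookrightarrow G_{\tilde\tau}$ be the inclusion $G_{\tilde\sigma}\hookrightarrow G_{\tilde\tau'}$ followed by conjugation by $g_{\sigma,\tau}$, $G_{\tilde\tau'}\to G_{\tilde\tau}$. $F(G)$ is the disjoint union of the finite groups $G_{\tilde v}$, where $v$ ranges over the vertices of $\underline{B}G$. The relation $\sim$ is the smallest equivalence relation on $F(G)$ such that (i) for each vertex $v$, if $g,h\in G_{\tilde v}$ are conjugate within $G_{\tilde v}$ then $g\sim h$; and (ii) for each edge $e$ of $\underline{B}G$ joining vertices $v,w$ and each $g\in G_{\tilde e}$, $\phi_e^v(g)\sim\phi_e^w(g)$ (where, if $v=w$, the two maps correspond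 to the two ends of $e$). The relation $\sim$ does not depend on the choices made of the elements $g_{\sigma,\tau}$. *)

(* Defs.v *)
From HB Require Import structures.
From mathcomp Require Import all_boot all_order all_algebra.
From mathcomp Require Import all_classical all_reals all_analysis.
Import Order.TTheory GRing.Theory Num.Theory numFieldNormedType.Exports.

Set Implicit Arguments.
Unset Strict Implicit.
Unset Printing Implicit Defensive.

Local Open Scope classical_set_scope.
Local Open Scope ring_scope.

Section Groups.
Variable G : groupType.
Local Open Scope group_scope.

Definition subgroup (H : set G) : Prop := group_closed [in H].

Definition finitely_generated : Prop :=
  exists s : seq G, forall H : set G,
    subgroup H -> [set` s] `<=` H -> H = setT.

Definition has_finite_order (g : G) : Prop :=
  exists n, (0 < n)%N /\ g ^+ n = 1.

Definition conj_class (g : G) : set G := [set g ^ k | k in [set: G]].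

Definition finite_order_classes : set (set G) :=
  [set conj_class g | g in has_finite_order].

End Groups.

Arguments finite_order_classes : clear implicits.

Section Discs.
Variable R : realType.

Definition sqnorm n (x : 'rV[R]_n) : R := \sum_(i < n) x 0 i ^+ 2.

Definition disc n : set 'rV[R]_n := [set x | sqnorm x <= 1].
Definition open_disc n : set 'rV[R]_n := [set x | sqnorm x < 1].
Definition sphere n : set 'rV[R]_n := [set x | sqnorm x = 1].

(* The two points of the sphere of dimension 0, the boundary of [disc 1]. *)
Definition endpoint (b : bool) : 'rV[R]_1 := const_mx (if b then 1 else -1).

End Discs.

Arguments disc : clear implicits.
Arguments open_disc : clear implicits.
Arguments sphere : clear implicits.

(* Whitehead's definition by characteristic maps. The maps [chi] are total,
   but only their restrictions to the closed disc are meaningful. That [chi s]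
   restricts to a homeomorphism from the open disc onto its image is a
   consequence of the axioms. *)
Record cw_complex (R : realType) (X : topologicalType) := CWComplex {
  cell : nat -> Type;
  chi : forall n, cell n -> 'rV[R]_n -> X;
  cw_hausdorff : hausdorff_space X;
  cw_continuous : forall n (s : cell n),
    {within disc R n, continuous (chi s)};
  cw_injective : forall n (s : cell n) (x y : 'rV[R]_n),
    open_disc R n x -> open_disc R n y -> chi s x = chi s y -> x = y;
  cw_disjoint : forall n (s : cell n) m (t : cell m),
    chi s @` open_disc R n `&` chi t @` open_disc R m !=set0 ->
    existT cell n s = existT cell m t;
  cw_cover : forall x : X,
    exists n (s : cell n), (chi s @` open_disc R n) x;
  cw_closure_finite : forall n (s : cell n),
    exists S : set {m : nat & cell m},
      [/\ finite_set S,
          forall p, S p -> (tag p < n)%N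
        & chi s @` sphere R n `<=`
            \bigcup_(p in S) (chi (tagged p) @` disc R (tag p))];
  cw_weak_topology : forall A : set X,
    (forall n (s : cell n), closed (A `&` chi s @` disc R n)) -> closed A
}.

Definition open_cell (R : realType) (X : topologicalType)
    (K : cw_complex R X) n (s : cell K n) : set X :=
  chi s @` open_disc R n.

(* [G] is discrete, so that the continuity of the action is the continuity of
   each of its translations. *)
Record continuous_action (G : groupType) (X : topologicalType) := Action {
  act : G -> X -> X;
  act1 : forall x, act 1%g x = x;
  actM : forall g h x, act (g * h)%g x = act g (act h x);
  act_continuous : forall g, continuous (act g)
}.

(* For a discrete group, a G-CW-complex is a CW-complex with an action that
   permutes the open cells, and such that an element that maps a cell to itself
   fixes it pointwise. *)
Record gcw_complex (R : realType) (G : groupType) (X : topologicalType) :=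
  GCWComplex {
  gcw_cw :> cw_complex R X;
  gcw_action : continuous_action G X;
  gcw_permute : forall g n (s : cell gcw_cw n), exists t : cell gcw_cw n,
    act gcw_action g @` open_cell s = open_cell t;
  gcw_rigid : forall g n (s : cell gcw_cw n),
    act gcw_action g @` open_cell s = open_cell s ->
    forall x, open_cell s x -> act gcw_action g x = x
}.

Section GCW.
Variables (R : realType) (G : groupType) (X : topologicalType).

Definition contractible (A : set X) : Prop :=
  exists2 x0 : X, A x0 &
  exists F : R * X -> X,
    [/\ {within `[0, 1]%classic `*` A, continuous F},
        forall t x, `[0, 1]%classic t -> A x -> A (F (t, x)),
        forall x, A x -> F (0, x) = x
      & forall x, A x -> F (1, x) = x0].

Variable K : gcw_complex R G X.

Definition translate (g : G) (A : set X) : set X :=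
  act (gcw_action K) g @` A.

Definition fixed_points (H : set G) : set X :=
  [set x | forall h, H h -> act (gcw_action K) h x = x].

Definition is_classifying_space_for_proper_actions : Prop :=
  forall H : set G, subgroup H ->
    (infinite_set H -> fixed_points H = set0) /\
    (finite_set H -> contractible (fixed_points H)).

Definition stabilizer n (s : cell K n) : set G :=
  [set g | translate g (open_cell s) = open_cell s].

Definition cell_orbit n (s : cell K n) : set (cell K n) :=
  [set t | exists g, translate g (open_cell s) = open_cell t].

(* The [n]-cells of the orbit space X/G: these are the images of the [n]-cells
   of X, and two cells of X have the same image if and only if they belong to
   the same orbit. *)
Definition orbit_cell n : Type :=
  {c : set (cell K n) | exists s, c = cell_orbit s}.

Definition to_orbit_cell n (s : cell K n) : orbit_cell n :=
  exist _ (cell_orbit s) (ex_intro _ s erefl).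

(* An edge [e] of X/G has two ends, indexed by [bool]. The end [b] is the vertex
   [to_orbit_cell (end_lift e b)], where [end_lift e b] is the vertex of X in
   the boundary of [lift e] to which [endpoint b] is attached. If the two ends
   of [e] are distinct vertices [v] and [w], then [end_elt e b] is the element
   denoted by [g_(e, v)] or [g_(e, w)]; if they coincide, the two lifts in the
   boundary of [lift e] give two elements. *)
Record lift_choice := LiftChoice {
  lift : forall n, orbit_cell n -> cell K n;
  liftP : forall n (c : orbit_cell n), sval c (lift c);
  end_lift : orbit_cell 1 -> bool -> cell K 0;
  end_liftP : forall e b,
    open_cell (end_lift e b) (chi (lift e) (endpoint R b));
  end_elt : orbit_cell 1 -> bool -> G;
  end_eltP : forall e b,
    translate (end_elt e b) (open_cell (end_lift e b)) =
    open_cell (lift (to_orbit_cell (end_lift e b)))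
}.

Lemma translate1 A : translate 1%g A = A.
Proof.
apply/seteqP; split=> [x [y Ay <-]|x Ax]; first by rewrite act1.
by exists x => //; rewrite act1.
Qed.

Lemma translateM g h A : translate (g * h)%g A = translate g (translate h A).
Proof.
apply/seteqP; split=> [x [y Ay <-]|x [_ [y Ay <-] <-]].
  by exists (act (gcw_action K) h y); [exists y|rewrite actM].
by exists y => //; rewrite actM.
Qed.

Lemma open_cell0E (v : cell K 0) x : open_cell v x -> open_cell v = [set x].
Proof.
move=> [a _ <-]; have E (b : 'rV[R]_0) : b = a by apply/rowP => -[].
have od : open_disc R 0 a by rewrite /open_disc /= /sqnorm big_ord0 ltr01.
apply/seteqP; split=> [y [b _ <-]|y ->]; first by rewrite (E b).
by exists a.
Qed.

Lemma stabilizer_endpoint (e : cell K 1) (b : bool) g :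
  stabilizer e g ->
  act (gcw_action K) g (chi e (endpoint R b)) = chi e (endpoint R b).
Proof.
move=> ge; set p := endpoint R b; set x := chi e p.
apply/eqP/negPn/negP => /eqP gxNx.
have := cw_hausdorff K; rewrite open_hausdorff => /(_ _ _ (introN eqP gxNx)).
move=> [[U V]] /= [/set_mem Ux /set_mem Vx] [oU oV UV].
have nW : nbhs x (act (gcw_action K) g @^-1` U `&` V).
  apply: filterI; last exact: open_nbhs_nbhs.
  by apply: act_continuous; exact: open_nbhs_nbhs.
have sqp t : sqnorm (t *: p) = t ^+ 2.
  rewrite /sqnorm big_ord1 !mxE exprMn; case: (b) => //.
    by rewrite expr1n mulr1.
  by rewrite sqrrN expr1n mulr1.
have dp : disc R 1 p by rewrite /disc /= -[p]scale1r sqp expr1n.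
have : within (disc R 1) (nbhs p) (chi e @^-1` (act (gcw_action K) g @^-1` U `&` V)).
  by have /subspace_continuousP /(_ p dp) := @cw_continuous _ _ K _ e; apply.
rewrite /within /= => near_p.
have ct : (fun t : R => t *: p) @ (1 : R) --> p.
  by rewrite -[X in _ --> X]scale1r; exact: scalel_continuous.
have : \forall t \near (1 : R)^'-,
    disc R 1 (t *: p) -> (chi e @^-1` (act (gcw_action K) g @^-1` U `&` V)) (t *: p).
  by apply: cvg_within; exact: (ct _ near_p).
move=> near_t.
have near01 : \forall t \near (1 : R)^'-, 0 < t < 1.
  near=> t; apply/andP; split; near: t; last exact: nbhs_left_lt.
  exact: nbhs_left_gt.
have [t [/andP[t0 t1] /= ht]] := filter_ex (filterI near01 near_t).
have t21 : sqnorm (t *: p) < 1 by rewrite sqp expr_lt1 // ltW.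
have [Ut Vt] := ht (ltW t21).
have ft : act (gcw_action K) g (chi e (t *: p)) = chi e (t *: p).
  by apply: (gcw_rigid ge); exists (t *: p).
suff : (U `&` V) (chi e (t *: p)) by rewrite (eqP UV).
by split => //; rewrite -ft.
Unshelve. all: by end_near. Qed.

Variable L : lift_choice.

Lemma edge_map_subproof (e : orbit_cell 1) (b : bool) (g : G) :
  stabilizer (lift L e) g ->
  stabilizer (lift L (to_orbit_cell (end_lift L e b)))
    (end_elt L e b * g * (end_elt L e b)^-1)%g.
Proof.
move=> ge; rewrite /stabilizer /= -end_eltP -translateM mulgVK translateM.
congr (translate _ _); rewrite (open_cell0E (end_liftP L e b)).
by rewrite /translate image_set1 stabilizer_endpoint.
Qed.

(* The disjoint union F(G) of the stabilizers of the lifts of the vertices of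
   X/G. *)
Definition vertex_group (v : orbit_cell 0) : Type :=
  {g : G | stabilizer (lift L v) g}.

Definition vertex_elts : Type := {v : orbit_cell 0 & vertex_group v}.

(* The map [phi_e^v], where [v] is the end [b] of [e]. *)
Definition edge_map (e : orbit_cell 1) (b : bool)
    (g : {g : G | stabilizer (lift L e) g}) :
    vertex_group (to_orbit_cell (end_lift L e b)) :=
  exist _ (end_elt L e b * sval g * (end_elt L e b)^-1)%g
    (edge_map_subproof b (svalP g)).

Inductive vertex_sim : vertex_elts -> vertex_elts -> Prop :=
| vertex_sim_refl x : vertex_sim x x
| vertex_sim_sym x y : vertex_sim x y -> vertex_sim y x
| vertex_sim_trans x y z : vertex_sim x y -> vertex_sim y z -> vertex_sim x z
| vertex_sim_conj (v : orbit_cell 0) (g h k : vertex_group v) :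
    sval h = (sval g ^ sval k)%g ->
    vertex_sim (existT vertex_group v g) (existT vertex_group v h)
| vertex_sim_edge (e : orbit_cell 1) (g : {g : G | stabilizer (lift L e) g}) :
    vertex_sim
      (existT vertex_group (to_orbit_cell (end_lift L e false))
        (edge_map false g))
      (existT vertex_group (to_orbit_cell (end_lift L e true))
        (edge_map true g)).

Definition vertex_sim_classes : set (set vertex_elts) :=
  [set [set y | vertex_sim x y] | x in [set: vertex_elts]].

End GCW.

Arguments vertex_sim_classes [R G X K] L _.

(* Main.v *)
Require Import Defs.
From mathcomp Require Import all_boot all_order all_algebra.
From mathcomp Require Import all_classical all_reals all_analysis.
From mathcomp Require Import ring lra.
Import Order.TTheory GRing.Theory Num.Theory numFieldNormedType.Exports.

Set Implicit Arguments.
Unset Strict Implicit.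
Unset Printing Implicit Defensive.

Local Open Scope classical_set_scope.
Local Open Scope card_scope.

(** Each element of the disjoint union F(G) is an element of G that fixes a
    vertex of the complex X, so it has a conjugacy class in G, and its order is
    finite because an infinite subgroup has no fixed point. The proof shows that
    two elements of F(G) are equivalent if and only if they are conjugate in G
    ([sim_value_class], [value_class_sim]), and that every conjugacy class of
    elements of finite order arises ([range_value_class]). The classes of the
    relation are then the nonempty fibers of a map onto the set of conjugacy
    classes, and there are as many of them as of conjugacy classes.

    Both nontrivial points rest on the fixed-point set X^g of an element g of
    finite order, which is contractible as the fixed-point set of the finite
    group generated by g. It is the realization of a subcomplex, that of the
    cells that g stabilizes ([realization_fixed_cells],
    [subcomplex_fixed_cells]). Being nonempty, this subcomplex has a vertex,
    hence a conjugate of g belongs to F(G). Being connected, it has a connected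
    1-skeleton ([vertices_connected]), so that two vertices that g fixes are
    joined by a path of edges that g fixes. Along such an edge the elements of
    F(G) that g gives at the two ends are related by a generator of the
    equivalence ([represents_edge]), and at one vertex the choice of the
    conjugator only matters up to conjugacy in the stabilizer
    ([represents_sim]).

    The connectedness of the 1-skeleton is proved by coloring. Suppose that a
    set of vertices is stable along the edges. Consider the largest subcomplex
    with all its vertices in this set, and the largest one with no vertex in it.
    They are disjoint and closed ([closed_realization]), and cover all the cells
    ([bicolored]), by induction on the dimension: the boundary of a cell of
    dimension at least 2 is the image of a connected sphere, so that it lies in
    one of the two, to which the cell can then be added. A connected complex is
    therefore equal to one of the two. *)

(** * Discs and spheres *)

Section Spheres.
Local Open Scope ring_scope.
Variable R : realType.

Lemma sqnorm_ge0 n (x : 'rV[R]_n) : 0 <= sqnorm x.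
Proof. by apply: sumr_ge0 => i _; exact: sqr_ge0. Qed.

Lemma sqnormZ n (a : R) (x : 'rV[R]_n) : sqnorm (a *: x) = a ^+ 2 * sqnorm x.
Proof.
by rewrite /sqnorm mulr_sumr; apply: eq_bigr => i _; rewrite !mxE exprMn.
Qed.

Lemma sqnormD n (x y : 'rV[R]_n) :
  sqnorm (x + y) = sqnorm x + sqnorm y + 2 * \sum_(i < n) x 0 i * y 0 i.
Proof.
rewrite /sqnorm mulr_sumr -!big_split; apply: eq_bigr => i _ /=.
by rewrite !mxE; ring.
Qed.

Lemma sqnorm_gt0 n (x : 'rV[R]_n) : x != 0 -> 0 < sqnorm x.
Proof.
move=> x0; rewrite lt_neqAle sqnorm_ge0 andbT eq_sym; apply: contra x0.
rewrite psumr_eq0 => [/allP x0|i _]; last exact: sqr_ge0.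
apply/eqP/rowP => i; rewrite mxE; apply/eqP.
by rewrite -sqrf_eq0; exact: (x0 i (mem_index_enum _)).
Qed.

Lemma sqnorm_continuous n : continuous (@sqnorm R n).
Proof.
apply: continuous_big => [|i _ x]; first exact: add_continuous.
apply: (@continuous_comp _ _ _ (fun y : 'rV[R]_n => y 0 i) (fun a => a ^+ 2)).
  exact: coord_continuous.
exact: exprn_continuous.
Qed.

Lemma normalize_sphere n (x : 'rV[R]_n) :
  x != 0 -> sphere R n ((Num.sqrt (sqnorm x))^-1 *: x).
Proof.
move=> x0; rewrite /sphere /= sqnormZ exprVn sqr_sqrtr ?sqnorm_ge0 //.
by rewrite mulVf // gt_eqF // sqnorm_gt0.
Qed.

Lemma closed_disc n : closed (disc R n).
Proof.
rewrite (_ : disc R n = @sqnorm R n @^-1` [set x | x <= 1]) //.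
apply: preimage_closed; last exact: closed_le.
by move=> x _; exact: sqnorm_continuous.
Qed.

Lemma closed_sphere n : closed (sphere R n).
Proof.
rewrite (_ : sphere R n = @sqnorm R n @^-1` [set x | x = 1]) //.
apply: preimage_closed; last exact: closed_eq.
by move=> x _; exact: sqnorm_continuous.
Qed.

Lemma compact_disc n : compact (disc R n).
Proof.
pose C := [set v : 'rV[R]_n | forall i, `[-1, 1]%classic (v ord0 i)].
apply: (@subclosed_compact _ _ C); first exact: closed_disc.
  apply: (@rV_compact R n (fun _ => `[-1, 1]%classic)) => i.
  exact: segment_compact.
move=> x dx i; rewrite /= in_itv /= -ler_norml -(@expr_le1 _ 2) //.
rewrite real_normK ?num_real // (le_trans _ dx) // /sqnorm (bigD1 i) //=.
by rewrite lerDl; apply: sumr_ge0 => j _; exact: sqr_ge0.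
Qed.

Lemma sphere_sub_disc n : sphere R n `<=` disc R n.
Proof. by move=> x; rewrite /sphere /disc /= => ->. Qed.

Lemma sphere_open_disc n (x : 'rV[R]_n) :
  disc R n x -> open_disc R n x \/ sphere R n x.
Proof. by rewrite /disc /= le_eqVlt => /orP[/eqP|]; [right|left]. Qed.

(** The normalised segment from [x] to [y] is an arc of the sphere: the segment
    misses the origin because [x] and [y] do not make an obtuse angle. *)
Lemma sphere_arc n (x y : 'rV[R]_n) : sphere R n x -> sphere R n y ->
  0 <= \sum_(i < n) x 0 i * y 0 i ->
  exists A, [/\ connected A, A `<=` sphere R n, A x & A y].
Proof.
move=> Sx Sy xy; pose l (t : R) : 'rV[R]_n := (1 - t) *: x + t *: y.
have l_neq0 t : `[0, 1]%classic t -> l t != 0.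
  rewrite /= in_itv /= => /andP[t0 t1].
  suff: 0 < sqnorm (l t).
    by apply: contraTneq => ->; rewrite -(scale0r x) sqnormZ expr0n mul0r ltxx.
  rewrite sqnormD !sqnormZ Sx Sy.
  under eq_bigr do rewrite !mxE mulrACA.
  rewrite -mulr_sumr.
  have : 0 <= (1 - t) * t by rewrite mulr_ge0 // subr_ge0.
  move=> /mulr_ge0 /(_ xy); nra.
have cl : continuous l.
  move=> t; apply: cvgD; apply: cvgZr_tmp; last exact: cvg_id.
  by apply: cvgB; [exact: cvg_cst|exact: cvg_id].
pose f t := (Num.sqrt (sqnorm (l t)))^-1 *: l t.
exists (f @` `[0, 1]%classic); split.
- apply: connected_continuous_connected; first exact: segment_connected.
  apply: continuous_in_subspaceT => t /set_mem t01.
  rewrite /f; apply: cvgZ; last exact: cl.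
  apply: cvgV; first by rewrite sqrtr_eq0 -ltNge sqnorm_gt0 // l_neq0.
  have cn : (@sqnorm R n \o l) @ t --> sqnorm (l t).
    by apply: (@cvg_comp _ _ _ l); [exact: cl|exact: sqnorm_continuous].
  exact: (cvg_comp _ _ cn (@sqrt_continuous R _)).
- by move=> _ [t t01 <-]; apply/normalize_sphere/l_neq0.
- exists 0; first by rewrite /= in_itv /= lexx ler01.
  by rewrite /f /l subr0 scale1r scale0r addr0 Sx sqrtr1 invr1 scale1r.
- exists 1; first by rewrite /= in_itv /= lexx ler01.
  by rewrite /f /l subrr scale1r scale0r add0r Sy sqrtr1 invr1 scale1r.
Qed.

(** The kernel of a linear form in at least 2 variables is nonzero. *)
Lemma sphere_orthogonal n (x : 'rV[R]_n.+2) :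
  exists2 z, sphere R n.+2 z & \sum_(i < n.+2) x 0 i * z 0 i = 0.
Proof.
have : kermx x^T != 0.
  rewrite -mxrank_eq0 mxrank_ker -lt0n subn_gt0.
  exact: leq_ltn_trans (rank_leq_col _) _.
move=> /rowV0Pn[v /sub_kermxP vx v0].
exists ((Num.sqrt (sqnorm v))^-1 *: v); first exact: normalize_sphere.
under eq_bigr do rewrite mxE mulrCA.
rewrite -mulr_sumr.
rewrite (_ : \sum_(i < n.+2) x 0 i * v 0 i = (v *m x^T) 0 0); last first.
  by rewrite mxE; apply: eq_bigr => i _; rewrite mxE mulrC.
by rewrite vx mxE mulr0.
Qed.

(** Any two points [x] and [y] are joined by two arcs, through a point that is
    orthogonal to [x] and lies on the same side as [y]. *)
Lemma connected_sphere n : connected (sphere R n.+2).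
Proof.
have arcs x y : sphere R n.+2 x -> sphere R n.+2 y ->
    exists A, [/\ connected A, A `<=` sphere R n.+2, A x & A y].
  move=> Sx Sy; have [z Sz xz] := sphere_orthogonal x.
  have [w [Sw xw wy]] : exists w, [/\ sphere R n.+2 w,
      0 <= \sum_(i < n.+2) x 0 i * w 0 i & 0 <= \sum_(i < n.+2) w 0 i * y 0 i].
    have [zy|/ltW zy] := leP 0 (\sum_(i < n.+2) z 0 i * y 0 i).
      by exists z; rewrite xz.
    exists (- z); split.
    - by rewrite -scaleN1r /sphere /= sqnormZ sqrrN expr1n mul1r.
    - by under eq_bigr do rewrite mxE mulrN; rewrite sumrN xz oppr0.
    - by under eq_bigr do rewrite mxE mulNr; rewrite sumrN oppr_ge0.
  have [A [cA AS Ax Aw]] := sphere_arc Sx Sw xw.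
  have [B [cB BS Bw By]] := sphere_arc Sw Sy wy.
  exists (A `|` B); split; [|by move=> t [/AS|/BS]|by left|by right].
  by apply: connectedU => //; exists w.
have [x Sx _] := sphere_orthogonal (0 : 'rV[R]_n.+2).
rewrite (_ : sphere R n.+2 = connected_component (sphere R n.+2) x).
  exact: component_connected.
apply/seteqP; split; last exact: connected_component_sub.
by move=> y /(arcs x y Sx)[A [cA AS Ax Ay]]; exists A.
Qed.

Lemma sphere1_endpoint (x : 'rV[R]_1) :
  sphere R 1 x -> exists b, x = endpoint R b.
Proof.
rewrite /sphere /sqnorm /= big_ord1 => /eqP; rewrite sqrf_eq1 => /orP[]/eqP x1.
  by exists true; apply/rowP => i; rewrite ord1 x1 mxE.
by exists false; apply/rowP => i; rewrite ord1 x1 mxE.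
Qed.

Lemma endpoint_sphere b : sphere R 1 (endpoint R b).
Proof.
rewrite /sphere /sqnorm /= big_ord1 mxE.
by case: b; rewrite ?sqrrN expr1n.
Qed.

Lemma sphere_neq0 n : sphere R n.+1 !=set0.
Proof.
by case: n => [|n]; [exists (endpoint R true); exact: endpoint_sphere|
  have [x Sx _] := sphere_orthogonal (0 : 'rV[R]_n.+2); exists x].
Qed.

End Spheres.

(** * Subcomplexes of a CW-complex *)

Section CWComplexes.
Variables (R : realType) (X : topologicalType) (K : cw_complex R X).

Local Notation any_cell := {n & cell K n}.
Implicit Types (p q : any_cell) (D Y : set any_cell) (P : set (cell K 0)).

Definition open_of p : set X := open_cell (tagged p).
Definition closed_of p : set X := chi (tagged p) @` disc R (tag p).
Definition boundary_of p : set X := chi (tagged p) @` sphere R (tag p).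

Lemma cell_unique p q x : open_of p x -> open_of q x -> p = q.
Proof.
move: p q => [n s] [m t] sx tx.
by apply: cw_disjoint; exists x; split.
Qed.

Lemma closed_ofE p : closed_of p = open_of p `|` boundary_of p.
Proof.
apply/seteqP; split=> [_ [a /sphere_open_disc[] ? <-]|x [|]].
- by left; exists a.
- by right; exists a.
- by move=> [a /ltW oa <-]; exists a.
- by move=> [a sa <-]; exists a => //; rewrite /disc /= sa.
Qed.

(** Closure-finiteness places the boundary in closed cells of lower dimension; a
    descent on the dimension reaches open ones. *)
Lemma boundary_cell p x :
  boundary_of p x -> exists2 q, (tag q < tag p)%N & open_of q x.
Proof.
have [n] := ubnP (tag p); elim: n => // n IH in p x * => pn px.
have [S [_ Sp]] := cw_closure_finite (tagged p).
move=> /(_ _ px)[q Sq]; rewrite -/(closed_of q) closed_ofE => -[qx|qx].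
  by exists q => //; exact: Sp.
have [|r rq rx] := IH q x _ qx; first exact: leq_trans (Sp _ Sq) _.
by exists r => //; exact: ltn_trans rq (Sp _ Sq).
Qed.

(** The image is compact, and X is Hausdorff. *)
Lemma closed_chi_image p A : A `<=` disc R (tag p) -> closed A ->
  closed (chi (tagged p) @` A).
Proof.
move=> Ad cA; apply: compact_closed; first exact: cw_hausdorff K.
apply: continuous_compact; last first.
  exact: subclosed_compact cA (@compact_disc _ _) Ad.
exact: continuous_subspaceW Ad (@cw_continuous _ _ K _ _).
Qed.

Lemma closed_closed_of p : closed (closed_of p).
Proof. exact: closed_chi_image (@subset_refl _ _) (@closed_disc _ _). Qed.

Lemma closed_boundary_of p : closed (boundary_of p).
Proof. exact: closed_chi_image (@sphere_sub_disc _ _) (@closed_sphere _ _). Qed.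

(** A point of the closed disc is the limit of the points [t *: x] of the open
    disc, for [t] less than 1. *)
Lemma closed_of_closure p : closed_of p `<=` closure (open_of p).
Proof.
move: p => [n s] _ [x dx <-] B nB.
have : within (disc R n) (nbhs x) (chi s @^-1` B).
  by have /subspace_continuousP /(_ x dx) := @cw_continuous _ _ K _ s; apply.
rewrite /within /= => near_x.
have ct : ((t *: x)%R @[t --> (1 : R)%R]) --> x.
  by rewrite -[X in _ --> X]scale1r; exact: scalel_continuous.
have near_t : \forall t \near ((1 : R)%R)^'-,
    disc R n (t *: x)%R -> (chi s @^-1` B) (t *: x)%R.
  by apply: cvg_within; exact: (ct _ near_x).
have near01 : \forall t \near ((1 : R)%R)^'-, (0 < t < 1)%R.
  near=> t; apply/andP; split; near: t; last exact: nbhs_left_lt.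
  exact/nbhs_left_gt/ltr01.
have [t [/andP[t0 t1] /= ht]] := filter_ex (filterI near01 near_t).
have o : open_disc R n (t *: x)%R.
  rewrite /open_disc /= sqnormZ (@le_lt_trans _ _ (t ^+ 2)%R) //.
    by rewrite ler_piMr ?sqr_ge0.
  by rewrite expr_lt1 // ltW.
exists (chi s (t *: x)%R); split; first by exists (t *: x)%R.
exact: ht (ltW o).
Unshelve. all: by end_near. Qed.

(** In a general CW-complex the closure of a cell can meet another cell without
    containing it, so this relation need not be transitive. *)
Definition face p q := closed_of p `&` open_of q !=set0.

Definition subcomplex D := forall p q, D p -> face p q -> D q.

Definition realization D : set X := \bigcup_(p in D) open_of p.

Lemma face_boundary p q :
  face p q -> q <> p -> boundary_of p `&` open_of q !=set0.
Proof.
move=> [x [+ qx]] qp; rewrite closed_ofE => -[px|px]; last by exists x.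
by case: qp; exact: cell_unique qx px.
Qed.

Lemma closed_of_sub_realization D p :
  subcomplex D -> D p -> closed_of p `<=` realization D.
Proof.
move=> Dsub Dp x px; have [n [s sx]] := cw_cover K x.
by exists (existT _ n s) => //; apply: Dsub Dp _; exists x.
Qed.

(** By the weak topology, it suffices to intersect with each closed cell, by
    induction on its dimension. If the cell does not belong to the subcomplex,
    only its boundary matters, and this is covered by finitely many closed cells
    of lower dimension. *)
Lemma closed_realization D : subcomplex D -> closed (realization D).
Proof.
move=> Dsub; apply: (@cw_weak_topology _ _ K) => n0 s.
rewrite -/(closed_of (existT _ n0 s)); move: (existT _ n0 s) => p {n0 s}.
have [n] := ubnP (tag p); elim: n => // n IH in p * => pn.
have [Dp|nDp] := pselect (D p).
  rewrite setIC setIidl; first exact: closed_closed_of.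
  exact: closed_of_sub_realization.
have [S [Sfin Slt Scover]] := cw_closure_finite (tagged p).
rewrite (_ : _ `&` _ =
  boundary_of p `&` \bigcup_(q in S) (realization D `&` closed_of q)).
  apply: closedI; first exact: closed_boundary_of.
  apply: (@closed_bigcup _ {classic any_cell}) => // q Sq; apply: IH.
  exact: leq_trans (Slt _ Sq) _.
apply/seteqP; split=> [x [[q Dq qx]]|x [px [q Sq [Dx _]]]].
  rewrite closed_ofE => -[px|px]; first by rewrite (cell_unique px qx) in nDp.
  split=> //; have [r Sr rx] := Scover _ px.
  by exists r => //; split => //; exists q.
by split=> //; rewrite closed_ofE; right.
Qed.

(** A cell of positive dimension has a nonempty boundary, which meets a cell of
    lower dimension. *)
Lemma subcomplex_vertex D p :
  subcomplex D -> D p -> exists v : cell K 0, D (existT _ 0 v).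
Proof.
move=> Dsub; have [n] := ubnP (tag p); elim: n => // n IH in p *.
case: p => -[|m] s /= sn Ds; first by exists s.
have [a Sa] := sphere_neq0 R m.
have [|q qs qx] := @boundary_cell (existT _ m.+1 s) (chi s a).
  by exists a.
apply: (IH q); first exact: leq_trans qs _.
apply: Dsub Ds _; exists (chi s a); rewrite closed_ofE.
by split=> //; right; exists a.
Qed.

End CWComplexes.

(** * Connectedness of the 1-skeleton *)

Section OneSkeleton.
Variables (R : realType) (X : topologicalType) (K : cw_complex R X).
Variable Y : set {n & cell K n}.
Hypothesis Ysub : subcomplex Y.

Local Notation any_cell := {n & cell K n}.
Local Notation vertex v := (existT (cell K) 0 v).
Implicit Types (p q : any_cell) (D : set any_cell) (P : set (cell K 0)).

(** The largest subcomplex of [Y] all of whose vertices belong to [P]. *)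
Definition full_subcomplex P : set any_cell :=
  [set p | exists D, [/\ subcomplex D, D `<=` Y, D p &
                         forall v, D (vertex v) -> P v]].

Lemma full_subcomplexP P : subcomplex (full_subcomplex P).
Proof.
move=> p q [D [Dsub DY Dp DP]] pq.
by exists D; split=> //; exact: Dsub Dp pq.
Qed.

Lemma full_subcomplex_vertex P v : full_subcomplex P (vertex v) -> P v.
Proof. by move=> [D [_ _ Dv]]; exact. Qed.

(** A common cell would yield a common vertex. *)
Lemma full_subcomplexC P :
  realization (full_subcomplex P) `&` realization (full_subcomplex (~` P))
  = set0.
Proof.
rewrite -subset0 => x [[p Pp px] [q Pq qx]].
rewrite {q qx}(cell_unique qx px) in Pq.
have Dsub : subcomplex (full_subcomplex P `&` full_subcomplex (~` P)).
  by move=> r s [Pr nPr] rs; split; exact: full_subcomplexP rs.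
have [v [Pv nPv]] := subcomplex_vertex Dsub (conj Pp Pq).
exact: (full_subcomplex_vertex nPv) (full_subcomplex_vertex Pv).
Qed.

(** Such a cell can be added to the subcomplex, since its proper faces already
    belong to it. *)
Lemma full_subcomplex_cell P p : Y p ->
  (forall v, p = vertex v -> P v) ->
  boundary_of p `<=` realization (full_subcomplex P) -> full_subcomplex P p.
Proof.
move=> Yp Pp pP; exists (full_subcomplex P `|` [set p]); split.
- move=> q r [Pq|->] qr; first by left; exact: full_subcomplexP qr.
  have [->|rp] := pselect (r = p); first by right.
  have [x [px rx]] := face_boundary qr rp.
  by left; have [s Ps sx] := pP _ px; rewrite (cell_unique rx sx).
- by move=> q [[D [_ + Dq _]]|->] //; exact.
- by right.
- by move=> v [/full_subcomplex_vertex//|/esym/Pp].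
Qed.

Variable P : set (cell K 0).
Hypothesis P_edge : forall (e : cell K 1) (a b : cell K 0),
  Y (existT _ 1 e) ->
  face (existT _ 1 e) (vertex a) -> face (existT _ 1 e) (vertex b) ->
  P a -> P b.

Lemma connected_bicolored (A : set X) : connected A ->
  A `<=` realization (full_subcomplex P) `|`
         realization (full_subcomplex (~` P)) ->
  A `<=` realization (full_subcomplex P) \/
  A `<=` realization (full_subcomplex (~` P)).
Proof.
move=> cA Asub; apply: connected_subset Asub cA.
have cl Q : closed (realization (full_subcomplex Q)).
  exact/closed_realization/full_subcomplexP.
by split; rewrite -(proj1 (closure_id _) (cl _)) full_subcomplexC.
Qed.

(** By induction on the dimension. The two colors agree on the boundary of an
    edge since [P] is stable along it, and on that of a cell of higher dimension
    since the sphere is connected. *)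
Lemma bicolored p : Y p -> full_subcomplex P p \/ full_subcomplex (~` P) p.
Proof.
have [n] := ubnP (tag p); elim: n => // n IH in p *; move=> pn Yp.
have face_Y x q : boundary_of p x -> open_of q x -> face p q.
  by move=> px qx; exists x; rewrite closed_ofE; split=> //; right.
have IHb : boundary_of p `<=`
    realization (full_subcomplex P) `|` realization (full_subcomplex (~` P)).
  move=> x px; have [q qp qx] := boundary_cell px.
  have [||Pq|Pq] := IH q; first exact: leq_trans qp _.
  - by apply: Ysub Yp _; exact: face_Y qx.
  - by left; exists q.
  - by right; exists q.
case: p => -[|[|m]] s in pn Yp face_Y IHb *.
- have [Ps|nPs] := pselect (P s); [left|right];
    apply: full_subcomplex_cell => //;
    try (by move=> v /(@eq_from_Tagged _ _ _ _ _) <-);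
    by move=> x /boundary_cell[q]; rewrite ltn0.
- pose p := existT (cell K) 1 s.
  suff [Q|Q] : boundary_of p `<=` realization (full_subcomplex P) \/
      boundary_of p `<=` realization (full_subcomplex (~` P)).
  + by left; exact: full_subcomplex_cell.
  + by right; exact: full_subcomplex_cell.
  have bv x : boundary_of (existT _ 1 s) x ->
      exists2 v, open_cell v x & face (existT _ 1 s) (vertex v).
    move=> px; have [[[|k] v] //= _ vx] := boundary_cell px.
    by exists v => //; exact: face_Y vx.
  have end_s : boundary_of (existT _ 1 s) (chi s (endpoint R true)).
    by exists (endpoint R true) => //; exact: endpoint_sphere.
  have [v _ sv] := bv _ end_s.
  have [Pv|nPv] := pselect (P v); [left|right] => x sx;
    have [w wx sw] := bv _ sx; have [[q Pq qx]|[q Pq qx]] := IHb x sx.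
  + by exists q.
  + rewrite (cell_unique qx (wx : open_of (vertex w) x)) in Pq.
    by case: (full_subcomplex_vertex Pq); exact: P_edge Yp sv sw Pv.
  + rewrite (cell_unique qx (wx : open_of (vertex w) x)) in Pq.
    by case: nPv; exact: P_edge Yp sw sv (full_subcomplex_vertex Pq).
  + by exists q.
- suff /connected_bicolored/(_ IHb)[Q|Q] : connected (boundary_of (Tagged _ s)).
  + by left; exact: full_subcomplex_cell.
  + by right; exact: full_subcomplex_cell.
  apply: connected_continuous_connected; first exact: connected_sphere.
  exact: continuous_subspaceW (@sphere_sub_disc _ _) (@cw_continuous _ _ K _ s).
Qed.

(** The edges of [Y] link any two of its vertices: [P] may be the class of a
    vertex for any equivalence relation that holds between the ends of each
    edge. *)
Lemma vertices_connected : connected (realization Y) ->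
  forall a b, Y (vertex a) -> Y (vertex b) -> P a -> P b.
Proof.
move=> cY a b Ya Yb Pa.
have in_realization v :
    Y (vertex v) -> exists2 x, open_cell v x & realization Y x.
  move=> Yv; have oz : open_disc R 0 0%R.
    by rewrite /open_disc /= /sqnorm big_ord0.
  by exists (chi v 0%R); [exists 0%R|exists (vertex v) => //; exists 0%R].
have [|YP|YP] := @connected_bicolored (realization Y) cY.
- by move=> x [p Yp px]; have [Pp|Pp] := bicolored Yp; [left|right]; exists p.
- have [x bx /YP[q Pq qx]] := in_realization _ Yb.
  apply: full_subcomplex_vertex.
  by rewrite (@cell_unique _ _ _ (vertex b) q x).
- have [x ax /YP[q Pq qx]] := in_realization _ Ya.
  have /(full_subcomplex_vertex)// : full_subcomplex (~` P) (vertex a).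
  by rewrite (@cell_unique _ _ _ (vertex a) q x).
Qed.

End OneSkeleton.

(** * Fixed points of the elements of the group *)

Section ProperActions.
Variables (R : realType) (G : groupType) (X : topologicalType).
Variable K : gcw_complex R G X.
Local Open Scope group_scope.

Local Notation any_cell := {n & cell K n}.
Local Notation act g x := (act (gcw_action K) g x).

Lemma translateK g (A B : set X) :
  translate K g A = B -> translate K g^-1 B = A.
Proof. by move=> <-; rewrite -translateM mulVg translate1. Qed.

Lemma open_cell_neq0 n (s : cell K n) : open_cell s !=set0.
Proof.
exists (chi s 0%R); exists 0%R => //.
by rewrite /open_disc /= -(scale0r (0%R : 'rV[R]_n)) sqnormZ expr0n mul0r ltr01.
Qed.

(** The translate of a cell is a cell, and two cells with a common point are
    equal. *)
Lemma fixed_point_stabilizer n (s : cell K n) g x :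
  open_cell s x -> act g x = x -> stabilizer s g.
Proof.
move=> sx gx; have [t gs] := gcw_permute g s.
rewrite /stabilizer /= /translate gs.
have tx : open_cell t x by rewrite -gs; exists x.
have E := @cell_unique _ _ K (existT _ n s) (existT _ n t) x sx tx.
by rewrite (@eq_from_Tagged _ (cell K) _ _ _ E).
Qed.

Lemma closed_fixed g : closed [set x | act g x = x].
Proof.
move=> x fx; apply: (cw_hausdorff K) => A B nA nB.
have nAB : nbhs x ((fun y => act g y) @^-1` A `&` B).
  by apply: filterI => //; exact: act_continuous nA.
by have [y [/= gy [Ay By]]] := fx _ nAB; exists y; split=> //; rewrite -gy.
Qed.

Definition fixed_cells g : set any_cell := [set p | stabilizer (tagged p) g].

Lemma realization_fixed_cells g :
  realization (fixed_cells g) = [set x | act g x = x].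
Proof.
apply/seteqP; split=> [x [p gp px]|x gx]; first exact: gcw_rigid gp _ px.
have [n [s sx]] := cw_cover K x.
by exists (existT _ n s) => //; exact: fixed_point_stabilizer gx.
Qed.

(** The set of the points fixed by [g] is closed, so that it contains the closed
    cell if it contains the open one. *)
Lemma subcomplex_fixed_cells g : subcomplex (fixed_cells g).
Proof.
move=> p q gp [x [/closed_of_closure px qx]].
apply: fixed_point_stabilizer qx _.
apply: (closed_fixed (g := g)); apply: closure_subset px => y py.
exact: gcw_rigid gp _ py.
Qed.

Lemma subgroup_stabilizer n (s : cell K n) : subgroup (stabilizer s).
Proof.
split; first by rewrite inE /stabilizer /= translate1.
move=> g h; rewrite !inE /stabilizer /= => gs hs.
by rewrite translateM (translateK hs).
Qed.

Lemma finite_subgroup_order (H : set G) g :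
  subgroup H -> finite_set H -> H g -> has_finite_order g.
Proof.
move=> [H1 HV] Hfin Hg.
have Hn n : H (g ^+ n).
  have HM := group_closedM (conj H1 HV).
  elim: n => [|n IH]; first by rewrite expg0; exact: set_mem.
  by rewrite expgS; apply/set_mem/HM; exact/mem_set.
have [] := pselect (injective (fun n => g ^+ n)) => [ginj|].
  case: infinite_nat.
  apply: (sub_finite_set _ (finite_preimage (B := H) _ Hfin)).
    by move=> n _; exact: Hn.
  by move=> m n _ _; exact: ginj.
move=> /existsNP[m] /existsNP[n] /not_implyP[].
wlog mn : m n / (m <= n)%N => [W E nE|gmn nmn].
  have [mn|/ltnW mn] := leqP m n; first exact: W mn E nE.
  by apply: W mn _ _ => // /esym.
exists (n - m)%N; rewrite subn_gt0 ltn_neqAle mn andbT; split; first exact/eqP.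
by apply: (mulgI (g ^+ m)); rewrite -expgnDr subnKC // mulg1.
Qed.

Lemma cyclic_subgroup g : has_finite_order g ->
  [/\ subgroup [set g ^+ i | i in [set: nat]],
      finite_set [set g ^+ i | i in [set: nat]] &
      fixed_points K [set g ^+ i | i in [set: nat]] = [set x | act g x = x]].
Proof.
move=> [n [n0 gn]].
have gmod i : g ^+ i = g ^+ (i %% n).
  by rewrite {1}(divn_eq i n) mulnC expgnDr expgnA gn expg1n mul1g.
split.
- split; first by apply/mem_set; exists 0%N.
  move=> _ _ /set_mem[i _ <-] /set_mem[j _ <-]; apply/mem_set.
  (* The inverse of [g ^+ j] is [g ^+ (n - j %% n)]. *)
  exists (i + (n - j %% n))%N => //.
  rewrite expgnDr (gmod j); congr (_ * _).
  apply: (mulgI (g ^+ (j %% n))); rewrite -expgnDr mulgV subnKC //.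
  by rewrite ltnW // ltn_mod.
- rewrite (_ : [set _ | _ in _] = [set g ^+ i | i in `I_n]).
    exact/finite_image/finite_II.
  apply/seteqP; split=> _ [i _ <-]; last by exists i.
  by exists (i %% n)%N; [rewrite /= ltn_mod|rewrite -gmod].
- apply/seteqP; split=> [x fx|x /= gx _ [i _ <-]].
    by apply: fx; exists 1%N.
  by elim: i => [|i IH]; rewrite ?act1 // expgS actM IH.
Qed.

(** The track of a point under the contraction joins it to the center. *)
Lemma contractible_connected (A : set X) : contractible R A -> connected A.
Proof.
move=> [x0 Ax0 [F [Fcont FA F0 F1]]].
rewrite (_ : A = connected_component A x0); first exact: component_connected.
apply/seteqP; split; last exact: connected_component_sub.
move=> x Ax; pose f t := F (t, x).
have f01 t : `[0%R, 1%R]%classic t -> A (f t) by move=> t01; exact: FA.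
exists (f @` `[0%R, 1%R]%classic); last first.
  by exists 0%R; [rewrite /= in_itv /= ler01 lexx|exact: F0].
split.
- by exists 1%R; [rewrite /= in_itv /= ler01 lexx|exact: F1].
- by move=> _ [t t01 <-]; exact: f01.
- apply: connected_continuous_connected; first exact: segment_connected.
  apply/subspace_continuousP => t t01.
  move/subspace_continuousP: Fcont => /(_ (t, x) (conj t01 Ax)) Fc.
  apply: cvg_trans Fc => B [[U V] [/= nU nV] UVB].
  apply: filterS nU => u Uu u01.
  by apply: (UVB (u, x)); split=> //=; exact: nbhs_singleton nV.
Qed.

End ProperActions.

Arguments fixed_cells [R G X] K g _.

(** * Conjugacy classes and the equivalence of vertex stabilizers *)

Section Representatives.
Variables (R : realType) (G : groupType) (X : topologicalType).
Variables (K : gcw_complex R G X) (L : lift_choice K).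
Local Open Scope group_scope.

Local Notation lift := Defs.lift.
Local Notation act g x := (act (gcw_action K) g x).
Local Notation vertex v := (existT (cell K) 0%N v).
Local Notation edge e := (existT (cell K) 1%N e).
Implicit Types (a b : cell K 0) (y z : vertex_elts L).

Definition value y : G := sval (tagged y).

(** A vertex [a] of X and an element [g] of its stabilizer determine an element
    of F(G) once a translation [k] from [a] to the chosen lift of its orbit is
    given. This relation keeps [k] unspecified. *)
Definition represents y a g := exists2 k,
  translate K k (open_cell a) = open_cell (lift L (tag y)) &
  value y = k * g * k^-1.

Lemma orbit_cell_eq n (c d : orbit_cell K n) k :
  translate K k (open_cell (lift L c)) = open_cell (lift L d) -> c = d.
Proof.
have [s cs] := svalP c; have [t dt] := svalP d.
have := liftP L c; have := liftP L d; move: (lift L c) (lift L d) => s' t'.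
rewrite cs dt => -[l tt'] [m ss'] kst.
suff : sval c = sval d by move: c d {cs dt} => [C ?] [D ?] /=; exact: eq_exist.
rewrite cs dt; apply/seteqP; split=> u [j ju].
  exists (j * m^-1 * k^-1 * l); rewrite !translateM tt' (translateK kst).
  by rewrite (translateK ss').
exists (j * l^-1 * k * m); rewrite !translateM ss' kst.
by rewrite (translateK tt').
Qed.

(** Two translations from [a] to the same lift differ by an element of the
    stabilizer of this lift. *)
Lemma represents_sim y z a g :
  represents y a g -> represents z a g -> vertex_sim y z.
Proof.
move: y z => [v h] [w l] [k /= ka hE] [m /= ma lE].
have vw : v = w.
  apply: (@orbit_cell_eq _ _ _ (m * k^-1)).
  by rewrite translateM (translateK ka).
move: w vw l ma lE => _ <- l ma lE.
have Sk : stabilizer (lift L v) (k * m^-1).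
  by rewrite /stabilizer /= translateM (translateK ma).
apply: (@vertex_sim_conj _ _ _ _ L v h l (exist _ (k * m^-1) Sk)).
move: hE lE; rewrite /value /= => -> ->.
by rewrite conjgE invgM invgK !mulgA !mulgVK.
Qed.

Lemma represents_exists a g : stabilizer a g -> exists y, represents y a g.
Proof.
move=> ga; have [k ka] := liftP L (to_orbit_cell a).
have S : stabilizer (lift L (to_orbit_cell a)) (k * g * k^-1).
  by rewrite /stabilizer /= !translateM -ka (translateK erefl) ga.
by exists (existT _ (to_orbit_cell a) (exist _ _ S)), k.
Qed.

Lemma represents_translate y a b g k :
  translate K k (open_cell a) = open_cell b ->
  represents y a g -> represents y b (k * g * k^-1).
Proof.
move=> kab [m ma yE]; exists (m * k^-1).
  by rewrite translateM (translateK kab).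
by rewrite yE invgM invgK !mulgA !mulgVK.
Qed.

Lemma represents_lift y : represents y (lift L (tag y)) (value y).
Proof. by exists 1; rewrite ?translate1 // mul1g invg1 mulg1. Qed.

(** The closed cells are the closures of the open ones, so that a translation
    that matches the open cells matches the closed ones, although it need not
    match their characteristic maps. *)
Lemma translate_closed_of n (s t : cell K n) k x :
  translate K k (open_cell s) = open_cell t ->
  closed_of (existT (cell K) n s) x ->
  closed_of (existT (cell K) n t) (act k x).
Proof.
move=> kst /closed_of_closure sx.
have cl : closed ((fun u => act k u) @^-1` closed_of (existT (cell K) n t)).
  apply: preimage_closed; last exact: closed_closed_of.
  by move=> u _; exact: act_continuous.
apply: (cl x); apply: closure_subset sx => u su.
by rewrite /= closed_ofE; left; rewrite /open_of /= -kst; exists u.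
Qed.

(** An end of [e] goes to a point of the closed edge [e'] outside of the open
    edge, since the translate of a vertex is a vertex. The translation may
    reverse the edge, so the index of the end is not determined. *)
Lemma translate_end (e e' : cell K 1) a k :
  translate K k (open_cell e) = open_cell e' ->
  face (edge e) (vertex a) ->
  exists b : bool, translate K k (open_cell a) = [set chi e' (endpoint R b)].
Proof.
move=> kee [x [ex ax]]; rewrite (open_cell0E ax) /translate image_set1.
have := translate_closed_of kee ex; rewrite closed_ofE => -[e'kx|[u /= Su ukx]].
  have ex' : open_cell e x.
    by rewrite -(translateK kee); exists (act k x); rewrite // -actM mulVg act1.
  by have /(congr1 tag) := @cell_unique _ _ K (edge e) (vertex a) x ex' ax.
have [b ub] := sphere1_endpoint Su.
by exists b; rewrite -ukx ub.
Qed.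

(** A translation to the chosen lift of the orbit of [e] carries [g] to an
    element of the stabilizer of this lift, and the images of this element at
    the two ends of the lift are related by a generator of the equivalence. *)
Lemma represents_edge (e : cell K 1) a b g y z :
  stabilizer e g ->
  face (edge e) (vertex a) -> face (edge e) (vertex b) ->
  represents y a g -> represents z b g -> vertex_sim y z.
Proof.
move=> ge ea eb ya zb.
pose c := to_orbit_cell e; have [k ke] : cell_orbit e (lift L c) := liftP L c.
have S : stabilizer (lift L c) (k * g * k^-1).
  by rewrite /stabilizer /= !translateM -ke (translateK erefl) ge.
pose E i : vertex_elts L := existT _ _ (edge_map i (exist _ _ S)).
have sim_E u d : face (edge e) (vertex d) -> represents u d g ->
    exists i, vertex_sim u (E i).
  move=> /(translate_end ke)[i kd] ud; exists i.
  rewrite -(open_cell0E (end_liftP L c i)) in kd.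
  apply: represents_sim (represents_translate kd ud) _.
  by exists (end_elt L c i); [exact: end_eltP|].
have [i yi] := sim_E _ _ ea ya; have [j zj] := sim_E _ _ eb zb.
apply: vertex_sim_trans yi (vertex_sim_trans _ (vertex_sim_sym zj)).
case: i j {zj} => -[]; do ?exact: vertex_sim_refl.
  exact/vertex_sim_sym/vertex_sim_edge.
exact: vertex_sim_edge.
Qed.

Lemma conj_class_conj (g k : G) : conj_class (g ^ k) = conj_class g.
Proof.
apply/seteqP; split=> _ [m _ <-]; first by exists (k * m); rewrite ?conjgM.
by exists (k^-1 * m) => //; rewrite -conjgM mulVKg.
Qed.

Definition value_class y : set G := conj_class (value y).

Lemma represents_class y a g : represents y a g -> value_class y = conj_class g.
Proof.
move=> [k _ yE]; rewrite /value_class yE -(conj_class_conj g k^-1).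
by rewrite conjgE invgK mulgA.
Qed.

Lemma sim_value_class y z : vertex_sim y z -> value_class y = value_class z.
Proof.
elim=> {y z} [//|y z _ ->//|y u z _ -> _ ->//|v g h k hgk|e g].
  by rewrite /value_class /value /= hgk conj_class_conj.
have class_end i :
    value_class (existT _ _ (edge_map i g)) = conj_class (sval g).
  apply: (@represents_class _ (end_lift L e i)).
  by exists (end_elt L e i); [exact: end_eltP|].
by rewrite !class_end.
Qed.

Hypothesis EG : is_classifying_space_for_proper_actions K.

(** The fixed-point set of the stabilizer of [a] contains [a], so that this
    stabilizer cannot be infinite. *)
Lemma stabilizer_order (a : cell K 0) g : stabilizer a g -> has_finite_order g.
Proof.
apply: finite_subgroup_order; first exact: subgroup_stabilizer.
apply: contrapT => /(proj1 (EG (subgroup_stabilizer a))) fix_empty.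
have [x ax] := open_cell_neq0 a.
suff : fixed_points K (stabilizer a) x by rewrite fix_empty.
by move=> h ha; exact: gcw_rigid ha _ ax.
Qed.

Lemma contractible_fixed g : has_finite_order g ->
  contractible R (realization (fixed_cells K g)).
Proof.
move=> /(cyclic_subgroup K)[sub fin fixE].
by rewrite realization_fixed_cells -fixE; exact: (proj2 (EG sub)).
Qed.

(** A translation moves the vertex of [z] to a vertex [b] at which [z] is
    represented by the same element [g] as [y] is at its own vertex [a]. Both
    [a] and [b] are then vertices of the connected complex of the cells that [g]
    fixes, and the set [P] of the vertices at which [g] yields an element
    equivalent to [y] is stable along its edges. *)
Lemma value_class_sim y z : value_class y = value_class z -> vertex_sim y z.
Proof.
move=> yz; pose g := value y; pose a := lift L (tag y).
have [k _ gk] : conj_class g (value z).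
  by move: yz; rewrite /value_class => ->; exists 1; rewrite ?conjg1.
have ya : represents y a g := represents_lift y.
have ga : stabilizer a g := svalP (tagged y).
have [b kb] : exists b : cell K 0,
  translate K k (open_cell (lift L (tag z))) = open_cell b := gcw_permute k _.
have zb : represents z b g.
  have := represents_translate kb (represents_lift z).
  by rewrite -gk conjgE !mulgA mulgV mul1g mulgK.
have gb : stabilizer b g.
  rewrite /stabilizer /= -kb -translateM conjgC gk translateM.
  by congr (translate K k _); exact: svalP (tagged z).
pose P := [set d : cell K 0 | exists2 u, represents u d g & vertex_sim y u].
have P_edge e c d : fixed_cells K g (edge e) ->
    face (edge e) (vertex c) -> face (edge e) (vertex d) -> P c -> P d.
  move=> ge ec ed [u uc yu].
  have [w wd] := represents_exists (subcomplex_fixed_cells ge ed).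
  exists w => //; apply: vertex_sim_trans yu _.
  exact: represents_edge ge ec ed uc wd.
have cY := contractible_connected (contractible_fixed (stabilizer_order ga)).
have Ysub := @subcomplex_fixed_cells _ _ _ K g.
have [|u ub yu] := vertices_connected Ysub P_edge cY ga gb.
  by exists y => //; exact: vertex_sim_refl.
exact: vertex_sim_trans yu (represents_sim ub zb).
Qed.

(** An element of finite order has a fixed point, hence fixes a cell, and then
    the vertices of the subcomplex of the cells that it fixes. *)
Lemma range_value_class : range value_class = finite_order_classes G.
Proof.
apply/seteqP; split=> [_ [y _ <-]|_ [g gfin <-]].
  by exists (value y) => //; exact: stabilizer_order (svalP (tagged y)).
have [x [p gp _] _] := contractible_fixed gfin.
have [a ga] := subcomplex_vertex (@subcomplex_fixed_cells _ _ _ K g) gp.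
have [y ya] := represents_exists ga.
by exists y => //; exact: represents_class ya.
Qed.

End Representatives.

Theorem lemma6 (R : realType) (G : groupType) (X : topologicalType)
    (K : gcw_complex R G X) (L : lift_choice K) :
  finitely_generated G ->
  is_classifying_space_for_proper_actions K ->
  finite_order_classes G #= vertex_sim_classes L.
Proof.
move=> _ EG; rewrite card_eq_sym -(range_value_class L EG).
pose fiber (D : set G) := [set y | @value_class _ _ _ _ L y = D].
rewrite (_ : vertex_sim_classes L = fiber @` range (@value_class _ _ _ _ L)).
  apply: inj_card_eq => _ D /set_mem[y _ <-] _ yD.
  by have : fiber (value_class y) y by []; rewrite yD.
rewrite /vertex_sim_classes image_comp; apply: eq_imagel => y _ /=.
apply/seteqP; split=> z; first by move=> /sim_value_class.
by move=> /esym/(value_class_sim EG).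
Qed.
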